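(* Let $(\mathcal{M},g,\overset{1}{\nabla})$ be an $n$-dimensional ($n\ge3$) GRW space-time with a semi-symmetric metric $P$-connection, $P$ unit timelike, which is a perfect fluid space-time, i.e. $\overset{g}{Ric}=a\,g+b\,\pi\otimes\pi$ for some scalars (functions) $a,b$. Then $\overset{1}{\mathcal{R}}\cdot\overset{1}{Ric}=0$.
   Context: Setting: $(\mathcal{M},g)$ is a Lorentzian manifold of signature $(-,+,\dots,+)$ with Levi-Civita connection $\overset{g}{\nabla}$; $P$ is a vector field with $g(P,P)=-1$, and $\pi(\cdot)=g(\cdot,P)$. The connection $\overset{1}{\nabla}_XY=\overset{g}{\nabla}_XY+\pi(Y)X-g(X,Y)P$ is a semi-symmetric metric $P$-connection, i.e. $\overset{1}{\nabla}P=0$; equivalently $\overset{g}{\nabla}_XP=X+\pi(X)P$ for all $X$. Such a manifold is a generalized Robertson-Walker (GRW) space-time (locally a warped product with metric $-(\mathrm dt)^2+f(t)^2g^*$, $g^*$ Riemannian). For $\overset{\ast}{\nabla}\in\{\overset{g}{\nabla},\overset{1}{\nabla}\}$ the curvature is $\overset{\ast}{R}(X,Y)Z=\overset{\ast}{\nabla}_X\overset{\ast}{\nabla}_YZ-\overset{\ast}{\nabla}_Y\overset{\ast}{\nabla}_XZ-\overset{\ast}{\nabla}_{[X,Y]}Z$ and the Ricci tensor is $\overset{\ast}{Ric}(Y,Z)=\mathrm{tr}(X\mapsto\overset{\ast}{R}(X,Y)Z)$. The tensor $\overset{1}{\mathcal{R}}\cdot\overset{1}{Ric}$ is defined by $(\overset{1}{\mathcal{R}}\cdot\overset{1}{Ric})(U,V;X,Y)=-\overset{1}{Ric}(\overset{1}{R}(X,Y)U,V)-\overset{1}{Ric}(U,\overset{1}{R}(X,Y)V)$.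 *)

(* Defs.v *)
From HB Require Import structures.
From mathcomp Require Import all_boot all_order all_algebra.
From mathcomp Require Import all_classical all_reals all_analysis.

Set Implicit Arguments.
Unset Strict Implicit.
Unset Printing Implicit Defensive.

Import Order.TTheory GRing.Theory Num.Theory.
Import numFieldNormedType.Exports.

Local Open Scope classical_set_scope.
Local Open Scope ring_scope.

Section SmoothMaps.
Variables (R : realType) (V W : normedModType R).

(* Meaningful for an open set A. *)
Fixpoint Ck (k : nat) (A : set V) (f : V -> W) : Prop :=
  match k with
  | 0%N => forall x, A x -> {for x, continuous f}
  | k'.+1 => (forall x, A x -> differentiable f x) /\
             (forall v : V, Ck k' A ('D_v f))
  end.

Definition smooth_on (A : set V) (f : V -> W) : Prop := forall k, Ck k A f.

Definition smooth_near (f : V -> W) (x : V) : Prop :=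
  exists A : set V, [/\ open A, A x & smooth_on A f].

End SmoothMaps.

Section Manifolds.
Variables (R : realType) (n : nat) (M : topologicalType).

(* cmap and cinv carry information only on cdom and on cmap @` cdom. *)
Record chart := Chart {
  cdom : set M;
  cmap : M -> 'rV[R]_n;
  cinv : 'rV[R]_n -> M;
  cdom_open : open cdom;
  cimg_open : open (cmap @` cdom);
  cmapK : forall p, cdom p -> cinv (cmap p) = p;
  cmap_continuous : forall p, cdom p -> {for p, continuous cmap};
  cinv_continuous : forall x, (cmap @` cdom) x -> {for x, continuous cinv}
}.

Definition transition (c c' : chart) : 'rV[R]_n -> 'rV[R]_n :=
  cmap c' \o cinv c.

Definition compatible (c c' : chart) : Prop :=
  smooth_on (cmap c @` (cdom c `&` cdom c')) (transition c c') /\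
  smooth_on (cmap c' @` (cdom c `&` cdom c')) (transition c' c).

(* A smooth structure is given by an atlas {chart_at p | p : M} with a preferred
   chart at each point; the maximal atlas it generates consists of the charts
   compatible with every chart_at p. *)
Record smooth_manifold := SmoothManifold {
  manifold_hausdorff : hausdorff_space M;
  manifold_second_countable : @second_countable M;
  chart_at : M -> chart;
  mem_chart_at : forall p, cdom (chart_at p) p;
  chart_at_compatible : forall p q, compatible (chart_at p) (chart_at q)
}.

(* The tangent space T_pM is represented by 'rV[R]_n, through the coordinates of
   the preferred chart at p, so a (not necessarily smooth) vector field X gives
   X p : 'rV[R]_n, to be read in chart_at p. *)
Definition field := M -> 'rV[R]_n.

(* Differential at q of the transition map from c to c': it sends the components
   in c of a tangent vector at q to its components in c'. *)
Definition tangent_change (c c' : chart) (q : M) (v : 'rV[R]_n) : 'rV[R]_n :=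
  'd (transition c c') (cmap c q) v.

Variable S : smooth_manifold.

Definition field_in_chart (c : chart) (X : field) : 'rV[R]_n -> 'rV[R]_n :=
  fun x => tangent_change (chart_at S (cinv c x)) c (cinv c x) (X (cinv c x)).

(* The vector field with constant components v in the chart c; meaningful on
   cdom c. *)
Definition constant_field (c : chart) (v : 'rV[R]_n) : field :=
  fun q => tangent_change c (chart_at S q) q v.

(* "smooth at p" means C^oo on a neighbourhood of p.  A total function which is
   smooth at p thus stands for a local function, or local vector field, defined
   around p. *)
Definition smooth_fun_at (f : M -> R) (p : M) : Prop :=
  smooth_near (f \o cinv (chart_at S p) : 'rV[R]_n -> R^o)
              (cmap (chart_at S p) p).

Definition smooth_field_at (X : field) (p : M) : Prop :=
  smooth_near (field_in_chart (chart_at S p) X) (cmap (chart_at S p) p).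

Definition derivation (X : field) (f : M -> R) : M -> R :=
  fun p => 'd (f \o cinv (chart_at S p) : 'rV[R]_n -> R^o)
              (cmap (chart_at S p) p) (X p).

(* [X, Y]^k = X(Y^k) - Y(X^k) in the coordinates of the preferred chart. *)
Definition lie_bracket (X Y : field) : field :=
  fun p => let c := chart_at S p in
    'd (field_in_chart c Y) (cmap c p) (X p)
    - 'd (field_in_chart c X) (cmap c p) (Y p).

(* g p is the Gram matrix of the scalar product on T_pM. *)
Definition metric (g : M -> 'M[R]_n) (X Y : field) : M -> R :=
  fun p => (X p *m g p *m (Y p)^T) 0 0.

Definition minkowski : 'M[R]_n :=
  diag_mx (\row_(i < n) if (i : nat) == 0%N then -1 else 1).

Record lorentzian_metric (g : M -> 'M[R]_n) : Prop := LorentzianMetric {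
  metric_symmetric : forall p, (g p)^T = g p;
  metric_signature : forall p,
    exists2 B : 'M[R]_n, B \in unitmx & B *m g p *m B^T = minkowski;
  metric_smooth : forall p X Y, smooth_field_at X p -> smooth_field_at Y p ->
    smooth_fun_at (metric g X Y) p
}.

(* An affine connection, acting on local vector fields; the Leibniz rule applied
   to locally constant f makes the value at p depend only on the germs at p. *)
Record connection (nabla : field -> field -> field) : Prop := Connection {
  nabla_smooth : forall p X Y, smooth_field_at X p -> smooth_field_at Y p ->
    smooth_field_at (nabla X Y) p;
  nablaDl : forall p X X' Y,
    smooth_field_at X p -> smooth_field_at X' p -> smooth_field_at Y p ->
    nabla (fun q => X q + X' q) Y p = nabla X Y p + nabla X' Y p;
  nablaZl : forall p f X Y,
    smooth_fun_at f p -> smooth_field_at X p -> smooth_field_at Y p ->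
    nabla (fun q => f q *: X q) Y p = f p *: nabla X Y p;
  nablaDr : forall p X Y Y',
    smooth_field_at X p -> smooth_field_at Y p -> smooth_field_at Y' p ->
    nabla X (fun q => Y q + Y' q) p = nabla X Y p + nabla X Y' p;
  nabla_leibniz : forall p f X Y,
    smooth_fun_at f p -> smooth_field_at X p -> smooth_field_at Y p ->
    nabla X (fun q => f q *: Y q) p
    = derivation X f p *: Y p + f p *: nabla X Y p
}.

Record levi_civita (g : M -> 'M[R]_n) (nabla : field -> field -> field) : Prop :=
  LeviCivita {
  levi_civita_connection : connection nabla;
  levi_civita_torsion_free : forall p X Y,
    smooth_field_at X p -> smooth_field_at Y p ->
    nabla X Y p - nabla Y X p = lie_bracket X Y p;
  levi_civita_metric : forall p X Y Z,
    smooth_field_at X p -> smooth_field_at Y p -> smooth_field_at Z p ->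
    derivation X (metric g Y Z) p
    = metric g (nabla X Y) Z p + metric g Y (nabla X Z) p
}.

Definition curvature (nabla : field -> field -> field) (X Y Z : field) : field :=
  fun p => nabla X (nabla Y Z) p - nabla Y (nabla X Z) p
           - nabla (lie_bracket X Y) Z p.

(* Trace of the endomorphism x |-> curvature(x, Y) Z of T_pM, a vector x in T_pM
   being extended to a field with constant components in chart_at p (by
   tensoriality the extension is irrelevant). *)
Definition ricci (nabla : field -> field -> field) (Y Z : field) : M -> R :=
  fun p => \tr (lin1_mx (fun x : 'rV[R]_n =>
    curvature nabla (constant_field (chart_at S p) x) Y Z p)).

Definition semi_symmetric_connection (g : M -> 'M[R]_n) (P : field)
    (nabla : field -> field -> field) : field -> field -> field :=
  fun X Y p => nabla X Y p + metric g Y P p *: X p - metric g X Y p *: P p.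

Definition parallel (nabla : field -> field -> field) (P : field) : Prop :=
  forall p X, smooth_field_at X p -> nabla X P p = 0.

Definition unit_timelike (g : M -> 'M[R]_n) (P : field) : Prop :=
  forall p, metric g P P p = -1.

(* Around each point there is a chart of the maximal atlas in which
   g = - dt^2 + f(t)^2 g*, where t is the coordinate of index i0 and g*, given by
   the entries of h with indices other than i0, depends only on the remaining
   coordinates. Smoothness and symmetry of g* follow from those of g. *)
Definition GRW_spacetime (g : M -> 'M[R]_n) : Prop :=
  forall p, exists c : chart, [/\ cdom c p,
    (forall q, compatible c (chart_at S q)) &
    exists (i0 : 'I_n) (f : R -> R) (h : 'rV[R]_n -> 'M[R]_n),
    let d := fun i : 'I_n => constant_field c (delta_mx 0 i) in
    [/\ (forall x y : 'rV[R]_n,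
           (forall j, j != i0 -> x 0 j = y 0 j) -> h x = h y),
        (forall q (v : 'rV[R]_n), cdom c q -> v != 0 -> v 0 i0 = 0 ->
           0 < (v *m h (cmap c q) *m v^T) 0 0) &
        forall q, cdom c q -> let t := cmap c q 0 i0 in
        [/\ 0 < f t, smooth_near (f : R^o -> R^o) t,
            metric g (d i0) (d i0) q = -1,
            (forall j, j != i0 -> metric g (d i0) (d j) q = 0) &
            forall i j, i != i0 -> j != i0 ->
              metric g (d i) (d j) q = f t ^+ 2 * h (cmap c q) i j]]].

Definition perfect_fluid (g : M -> 'M[R]_n) (P : field)
    (nabla : field -> field -> field) : Prop :=
  exists a b : M -> R, forall p Y Z,
    smooth_field_at Y p -> smooth_field_at Z p ->
    ricci nabla Y Z p
    = a p * metric g Y Z p + b p * (metric g Y P p * metric g Z P p).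

Definition curvature_dot_ricci (nabla : field -> field -> field)
    (U V X Y : field) : M -> R :=
  fun p => - ricci nabla (curvature nabla X Y U) V p
           - ricci nabla U (curvature nabla X Y V) p.

End Manifolds.

(* Main.v *)
From HB Require Import structures.
Require Import Defs.
From mathcomp Require Import all_boot all_order all_algebra.
From mathcomp Require Import all_classical all_reals all_analysis.
From mathcomp Require Import ring.

Set Implicit Arguments.
Unset Strict Implicit.
Unset Printing Implicit Defensive.

Import Order.TTheory GRing.Theory Num.Theory.
Import numFieldNormedType.Exports.

Local Open Scope classical_set_scope.
Local Open Scope ring_scope.

(** Write D for the Levi-Civita connection, E for the semi-symmetric one, R_D
    and R_E for their curvatures, Ric_D and Ric_E for their Ricci tensors, and
    pi for g(-, P).

    Three facts about E decide everything.  Since E P = 0 near every point,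
    R_E(X, Y) P = 0 ([curvature_P]).  Since E is metric, R_E(X, Y) is
    skew-adjoint for g ([curvature_skew]); together these say that
    R_E(X, Y) U is always orthogonal to P.  Finally D_X P = X + pi(X) P, and
    substituting this in the definition of R_E gives
    R_E(X, Y) Z = R_D(X, Y) Z - (g(Y, Z) X - g(X, Z) Y)
    ([curvature_semi_symmetric]), whose trace is
    Ric_E = Ric_D - (n - 1) g ([ricci_semi_symmetric]).

    For a perfect fluid Ric_E is therefore a combination of g and pi (x) pi.
    As Ric_E(P, P) = 0, the two coefficients agree: Ric_E = b (g + pi (x) pi)
    ([ricci_fluid]).  Applying R_E(X, Y) as a derivation to this tensor, the
    g part vanishes by skew-adjointness and the pi (x) pi part because
    pi o R_E(X, Y) = 0.

    Most of the text is the calculus behind this computation.  Covariant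
    derivatives are iterated, so identities known at one point must be
    differentiated: they have to hold near the point, although smoothness at a
    point is tested in the preferred chart of that very point.  Hence smoothness
    must be carried from chart to chart ([near_smooth_field]), which takes the
    stability of C^k maps under composition ([Ck_comp]).  Skew-adjointness of
    the curvature rests on X(Y f) - Y(X f) = [X, Y] f
    ([derivation_commutator]), that is, on the symmetry of second derivatives
    ([derive_comm]). *)

(** * Germs and products under the differential *)

Section Differentials.
Variables (R : realType) (V W : normedModType R).
Implicit Types (f g : V -> W) (x v : V).

Let near_eq_diff_aux f g x : {near x, f =1 g} -> differentiable f x ->
  continuous ('d f x) /\ g \o shift x = cst (g x) + 'd f x +o_ 0 id.
Proof.
move=> fg /diff_locallyP[cf df]; split=> //; apply/eqaddoP => _/posnumP[e].
have /eqaddoP/(_ _ (gt0 e)) := df.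
have fg0 : \forall y \near 0, f (y + x) = g (y + x).
  by move: fg; rewrite (near_shift 0)/=; apply: filterS => y; rewrite /= subr0.
apply: filterS2 fg0 => y fgy.
by rewrite -[(_ - _) y]/(_ y - _ y) -[in X in _ -> X](nbhs_singleton fg) /= fgy.
Qed.

Lemma near_eq_differentiable f g x :
  {near x, f =1 g} -> differentiable f x -> differentiable g x.
Proof.
move=> fg df; have [cf eg] := near_eq_diff_aux fg df.
have e : 'd g x = 'd f x :> (V -> W) by exact: diff_unique eg.
by apply/diff_locallyP; rewrite e.
Qed.

Lemma near_eq_diff f g x :
  {near x, f =1 g} -> differentiable f x -> 'd g x = 'd f x :> (V -> W).
Proof.
by move=> fg df; have [cf eg] := near_eq_diff_aux fg df; exact: diff_unique eg.
Qed.

(** Scaling is registered as a bilinear map so that the product rule for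
    [h *: f] is the differential of a bounded bilinear map along a pair. *)
Lemma scale_is_bilinear :
  bilinear_for
    (GRing.Scale.Law.clone _ _ *:%R _) (GRing.Scale.Law.clone _ _ *:%R _)
    (@GRing.scale R W : R^o -> W -> W).
Proof.
split=> [w|a] b u z /=.
- by rewrite scalerDl scalerA.
- by rewrite scalerDr !scalerA mulrC.
Qed.
HB.instance Definition _ :=
  bilinear_isBilinear.Build R R^o W W _ _ (@GRing.scale R W : R^o -> W -> W)
    scale_is_bilinear.

Lemma is_diff_scale (h : V -> R^o) f x :
  differentiable h x -> differentiable f x ->
  is_diff x (fun y => h y *: f y) (fun v => h x *: 'd f x v + 'd h x v *: f x).
Proof.
move=> dh df.
have sc : continuous (fun p : R^o * W => p.1 *: p.2).
  by move=> p; apply: scale_continuous.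
have dp := differentiable_pair dh df.
have ds := @differentiable_bilin _ _ _ _
  (@GRing.scale R W : {bilinear R^o -> W -> W}) (h x, f x) sc.
rewrite (_ : (fun y => _) =
  (fun p : R^o * W => p.1 *: p.2) \o (fun y => (h y, f y)))//.
split; first exact: differentiable_comp.
rewrite diff_comp// diff_pair//.
by rewrite (@diff_bilin _ _ _ _ (@GRing.scale R W : {bilinear R^o -> W -> W})).
Qed.

End Differentials.

(** * Maps of class C^k *)

Section RowCoordinates.
Variables (R : realType) (n : nat) (j : 'I_n).

Definition row_coord (v : 'rV[R]_n) : R^o := v 0 j.

Lemma row_coord_is_linear : linear row_coord.
Proof. by move=> a u w; rewrite /row_coord !mxE. Qed.
HB.instance Definition _ :=
  GRing.isLinear.Build R 'rV[R]_n R^o _ row_coord row_coord_is_linear.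

Lemma continuous_row_coord : continuous row_coord.
Proof. exact: coord_continuous. Qed.

End RowCoordinates.

Section SmoothCalculus.
Variable R : realType.

Lemma open_near (V : normedModType R) (A : set V) (Q : V -> Prop) x :
  open A -> A x -> (forall y, A y -> Q y) -> \forall y \near x, Q y.
Proof. by move=> oA Ax AQ; apply: filterS AQ _; exact: open_nbhs_nbhs. Qed.

Section Generic.
Variables V W : normedModType R.
Implicit Types (A B : set V) (f g : V -> W) (k : nat).

(** A C^k condition on an open set only sees the values on that set: every
    derivative it iterates is local. *)
Lemma Ck_eq k A f g : open A -> (forall x, A x -> f x = g x) ->
  Ck k A f -> Ck k A g.
Proof.
move=> oA; elim: k f g => [|k IHk] f g fg /=.
  move=> cf x Ax; have nfg : {near x, f =1 g} by exact: (open_near oA Ax).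
  rewrite /prop_for /continuous_at -fg//.
  by apply: cvg_trans (cf x Ax); exact: near_eq_cvg.
case=> df cf; split=> [x Ax|v].
  by apply: near_eq_differentiable (df x Ax); exact: (open_near oA Ax).
apply: IHk (cf v) => x Ax.
by apply: near_eq_derive; exact: (open_near oA Ax).
Qed.

Lemma Ck_sub k A B f : B `<=` A -> Ck k A f -> Ck k B f.
Proof.
move=> BA; elim: k f => [|k IHk] f /=; first by move=> cf x /BA /cf.
by case=> df cf; split=> [x /BA /df|v] //; exact: IHk.
Qed.

Lemma CkW k A f : Ck k.+1 A f -> Ck k A f.
Proof.
elim: k f => [|k IHk] f.
  by case=> df _ x Ax; exact/differentiable_continuous/df.
by case=> df cf; split=> // v; exact/IHk/cf.
Qed.

Lemma Ck_cst k A (c : W) : Ck k A (fun=> c).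
Proof.
elim: k c => [|k IHk] c /=; first by move=> x _; exact: cst_continuous.
split=> [x _|v]; first exact: differentiable_cst.
rewrite (_ : 'D_v _ = fun=> 0) //; apply/funext => x.
exact: derive_cst.
Qed.

Lemma Ck_add k A f g : open A -> Ck k A f -> Ck k A g ->
  Ck k A (fun x => f x + g x).
Proof.
move=> oA; elim: k f g => [|k IHk] f g /=.
  by move=> cf cg x Ax; apply: continuousD; [exact: cf|exact: cg].
case=> df cf [dg cg]; split=> [x Ax|v].
  by apply: differentiableD; [exact: df|exact: dg].
apply: Ck_eq (IHk _ _ (cf v) (cg v)) => // x Ax.
by rewrite -[LHS]deriveD //; apply: diff_derivable; [exact: df|exact: dg].
Qed.

Lemma Ck_sum k A m (f : 'I_m -> V -> W) : open A ->
  (forall i, Ck k A (f i)) -> Ck k A (fun x => \sum_i f i x).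
Proof.
move=> oA cf; rewrite (_ : (fun x => _) = \sum_i f i); last first.
  by rewrite funeqE => x; rewrite fct_sumE.
elim/big_ind : _ => [|u v cu cv|i _] //; first exact: Ck_cst.
exact: Ck_add.
Qed.

End Generic.

Section Products.
Variables V W : normedModType R.
Implicit Types (A : set V) (f : V -> W) (k : nat).

(** The Leibniz formula expresses the first derivatives of a product by
    products of class C^k, hence an induction on k; [CkW] lets the factors that
    are not differentiated lose one order. *)
Lemma Ck_scale k A (h : V -> R^o) f : open A -> Ck k A h -> Ck k A f ->
  Ck k A (fun x => h x *: f x).
Proof.
move=> oA; elim: k h f => [|k IHk] h f.
  move=> /= ch cf x Ax; apply: cvgZ; [exact: ch|exact: cf].
move=> chS cfS; have [ch cf] := (CkW chS, CkW cfS).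
case: chS cfS => dh dch [df dcf]; split=> [x Ax|v].
  by have [] := is_diff_scale (dh x Ax) (df x Ax).
apply: Ck_eq (Ck_add oA (IHk _ _ ch (dcf v)) (IHk _ _ (dch v) cf)) => // x Ax.
have [dhf e] := is_diff_scale (dh x Ax) (df x Ax).
rewrite [RHS]deriveE// e !deriveE//; [exact: dh|exact: df].
Qed.

Lemma Ck_linear_comp (Z : normedModType R) (L : {linear W -> Z}) k A f :
  open A -> continuous L -> Ck k A f -> Ck k A (L \o f).
Proof.
move=> oA cL; elim: k f => [|k IHk] f.
  by move=> /= cf x Ax; apply: continuous_comp; [exact: cf|exact: cL].
have dL y : differentiable L y by exact: linear_differentiable.
case=> df cf; split=> [x Ax|v]; first exact: differentiable_comp (df x Ax) _.
apply: Ck_eq (IHk _ (cf v)) => // x Ax; have dfx := df x Ax.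
rewrite /= [RHS]deriveE; last exact: differentiable_comp.
by rewrite diff_comp// diff_lin// deriveE.
Qed.

End Products.

Section RowVectors.
Variables (n : nat) (V Z : normedModType R).
Implicit Types (A : set V) (B : set 'rV[R]_n).

Lemma Ck_coord k A (f : V -> 'rV[R]_n) j : open A -> Ck k A f ->
  Ck k A (fun x => f x 0 j : R^o).
Proof.
by move=> oA; apply: (Ck_linear_comp oA (@continuous_row_coord _ _ j)).
Qed.

(** Expanding [v] in the finite standard basis turns ['d F (psi x) (v x)] into a
    sum of products of class C^k. *)
Lemma Ck_diff_apply k A (F : 'rV[R]_n -> Z) (psi v : V -> 'rV[R]_n) :
  open A -> (forall x, A x -> differentiable F (psi x)) ->
  (forall j, Ck k A ('D_(delta_mx 0 j) F \o psi)) -> Ck k A v ->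
  Ck k A (fun x => 'd F (psi x) (v x)).
Proof.
move=> oA dF cF cv.
apply: Ck_eq (Ck_sum oA (fun j => Ck_scale oA (Ck_coord j oA cv) (cF j))) => //.
move=> x Ax; rewrite [in RHS](row_sum_delta (v x)) linear_sum.
by apply: eq_bigr => j _; rewrite linearZ /= deriveE//; exact: dF.
Qed.

(** By the chain rule a directional derivative of [F \o psi] is the expression
    treated in [Ck_diff_apply], whose factors ['D_w F \o psi] are compositions
    of one order less. *)
Lemma Ck_comp k A B (F : 'rV[R]_n -> Z) (psi : V -> 'rV[R]_n) :
  open A -> (forall x, A x -> B (psi x)) ->
  Ck k B F -> Ck k A psi -> Ck k A (F \o psi).
Proof.
move=> oA AB; elim: k F psi AB => [|k IHk] F psi AB.
  move=> /= cF cpsi x Ax; apply: continuous_comp; first exact: cpsi.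
  exact/cF/AB.
case=> dF cF cpsiS; have cpsi := CkW cpsiS; case: cpsiS => dpsi cdpsi.
split=> [x Ax|v].
  by apply: differentiable_comp; [exact: dpsi|exact/dF/AB].
have := @Ck_diff_apply k A F psi ('D_v psi) oA.
have dF' x : A x -> differentiable F (psi x) by move=> /AB /dF.
move=> /(_ dF' (fun j => IHk _ _ AB (cF _) cpsi) (cdpsi v)).
apply: Ck_eq => // x Ax; have dpx := dpsi x Ax; have dFx := dF' x Ax.
rewrite [RHS]deriveE; last exact: differentiable_comp.
by rewrite (deriveE v dpx) (diff_comp dpx dFx).
Qed.

End RowVectors.

End SmoothCalculus.

(** * Symmetry of second derivatives *)

Section SymmetryOfSecondDerivatives.
Variables (R : realType) (V : normedModType R).
Implicit Types (f : V -> R^o) (A : set V) (x v w : V) (s t h : R).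

Lemma is_derive_line f x v s : derivable f (x + s *: v) v ->
  is_derive s 1 (fun t => f (x + t *: v)) ('D_v f (x + s *: v)).
Proof.
have e : (fun h : R => h^-1 *: (f (x + (h *: 1 + s) *: v) - f (x + s *: v)))
       = (fun h => h^-1 *: (f (h *: v + (x + s *: v)) - f (x + s *: v))).
  by apply/funext => h; rewrite scalerDl [h *: 1]mulr1 addrCA.
by move=> df; split; rewrite /derivable /derive e.
Qed.

(** The mean value theorem applied twice: first to the difference along [h *: w]
    as a function of the step along [v], then to ['D_v f] along [w]. *)
Lemma second_difference_MVT f A x v w h :
  Ck 2 A f -> 0 < h ->
  (forall s t, s \in `[0, h] -> t \in `[0, h] -> A (x + s *: v + t *: w)) ->
  exists s t, [/\ s \in `[0, h], t \in `[0, h] &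
    f (x + h *: v + h *: w) - f (x + h *: v) - (f (x + h *: w) - f x)
    = 'D_w ('D_v f) (x + s *: v + t *: w) * h * h].
Proof.
move=> [df d2f] h0 box.
have m0 : 0 \in `[0, h] by rewrite in_itv /= lexx ltW.
have mh : h \in `[0, h] by rewrite in_itv /= lexx ltW.
have [dvf _] := d2f v.
pose u s : R := f (x + h *: w + s *: v) - f (x + s *: v).
pose du s : R := 'D_v f (x + h *: w + s *: v) - 'D_v f (x + s *: v).
have uD s : s \in `[0, h] -> is_derive s 1 u (du s).
  move=> sh; apply: is_deriveB; apply: is_derive_line.
    by apply/diff_derivable/df; rewrite addrAC; exact: box.
  by apply/diff_derivable/df; rewrite -[_ + _]addr0 -(scale0r w); exact: box.
have itvW s : s \in `]0, h[ -> s \in `[0, h].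
  by rewrite !in_itv /= => /andP[/ltW -> /ltW ->].
have uc : {within `[0, h], continuous u}.
  by apply: derivable_within_continuous => s /uD [].
have [s /itvW sh us] := MVT h0 (fun s m => uD s (itvW s m)) uc.
pose r t : R := 'D_v f (x + s *: v + t *: w).
have rD t : t \in `[0, h] -> is_derive t 1 r ('D_w ('D_v f) (x + s *: v + t *: w)).
  by move=> th; apply/is_derive_line/diff_derivable/dvf; exact: box.
have rc : {within `[0, h], continuous r}.
  by apply: derivable_within_continuous => t /rD [].
have [t /itvW th rt] := MVT h0 (fun t m => rD t (itvW t m)) rc.
exists s, t; split=> //.
move: us rt; rewrite !subr0 /u /du /r !scale0r !addr0 => us <-.
by rewrite [x + s *: v + h *: w]addrAC -us [x + h *: w + h *: v]addrAC.
Qed.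

Lemma near_box x v w (U : set V) : nbhs x U ->
  exists2 h : R, 0 < h &
    forall s t, s \in `[0, h] -> t \in `[0, h] -> U (x + s *: v + t *: w).
Proof.
move=> Ux.
have c : {for (0, 0), continuous (fun z : R^o * R^o => x + z.1 *: v + z.2 *: w)}.
  apply: cvgD; [apply: cvgD; first exact: cvg_cst|];
    apply: cvgZr_tmp; [exact: cvg_fst|exact: cvg_snd].
have /c/nbhs_ballP[e /= e0 eU] : nbhs (x + 0 *: v + 0 *: w) U.
  by rewrite !scale0r !addr0.
exists (e / 2); first by rewrite divr_gt0.
have lt z : z \in `[0, e / 2] -> ball (0 : R^o) e z.
  rewrite in_itv /= => /andP[z0 ze].
  rewrite -ball_normE /= sub0r normrN ger0_norm//.
  by rewrite (le_lt_trans ze)// ltr_pdivrMr// ltr_pMr// ltr1n.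
by move=> s t /lt bs /lt bt; apply: (eU (s, t)).
Qed.

(** The second difference over a small parallelogram is symmetric in [v] and
    [w], and up to the factor h^2 it is a value of either mixed derivative near
    [x]; continuity of both forces them to agree at [x]. *)
Lemma derive_comm f A x v w : open A -> A x -> Ck 2 A f ->
  'D_w ('D_v f) x = 'D_v ('D_w f) x.
Proof.
move=> oA Ax cf; apply/eqP; apply: contraT => neq.
set a := 'D_w _ _ in neq *; set b := 'D_v _ _ in neq *.
pose e := `|a - b| / 2.
have e0 : 0 < e by rewrite divr_gt0// normr_gt0 subr_eq0.
have [_ d2f] := cf.
have cvw : {for x, continuous ('D_w ('D_v f))} by have [_ c] := d2f v; exact: c.
have cwv : {for x, continuous ('D_v ('D_w f))} by have [_ c] := d2f w; exact: c.
have U : \forall y \near x, [/\ A y, `|a - 'D_w ('D_v f) y| < e &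
                               `|b - 'D_v ('D_w f) y| < e].
  have nA : nbhs x A by exact: open_nbhs_nbhs.
  have nvw : \forall y \near x, `|a - 'D_w ('D_v f) y| < e.
    exact: (cvgrPdist_lt _ _).1 cvw e e0.
  have nwv : \forall y \near x, `|b - 'D_v ('D_w f) y| < e.
    exact: (cvgrPdist_lt _ _).1 cwv e e0.
  by apply: filterS3 nA nvw nwv => y.
have [h h0 box] := near_box v w U.
have [|s [t [sh th E1]]] := @second_difference_MVT f A x v w h cf h0.
  by move=> s t sh th; have [] := box _ _ sh th.
have [|t' [s' [th' sh' E2]]] := @second_difference_MVT f A x w v h cf h0.
  by move=> t' s' th' sh'; rewrite addrAC; have [] := box _ _ sh' th'.
have [_ B1 _] := box _ _ sh th.
have [_ _] := box _ _ sh' th'; rewrite [x + s' *: v + _]addrAC => B2.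
have hn0 : h != 0 by rewrite gt_eqF.
have cancel_h (c d : R) : c * h * h = d * h * h -> c = d.
  by move=> /(mulIf hn0)/(mulIf hn0).
have swap (c d c' d' : R) : c - d - (c' - d') = c - c' - (d - d') by ring.
rewrite [x + h *: w + h *: v]addrAC swap in E2.
have E := cancel_h _ _ (etrans (esym E1) E2).
have close (c d z : R) : `|c - z| < e -> `|d - z| < e -> `|c - d| < e + e.
  move=> cz dz; apply: le_lt_trans (ler_distD z c d) _.
  by rewrite (distrC z); exact: ltrD cz dz.
rewrite E in B1; have := close _ _ _ B1 B2.
by rewrite -splitr ltxx.
Qed.

End SymmetryOfSecondDerivatives.

(** * Germs of smooth maps *)

Section SmoothGerms.
Variable R : realType.

Section Generic.
Variables V W : normedModType R.
Implicit Types (f g : V -> W) (h : V -> R^o) (x : V).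

Lemma smooth_near_eq f g x :
  {near x, f =1 g} -> smooth_near f x -> smooth_near g x.
Proof.
move=> fg [A [oA Ax sf]]; exists (A `&` [set y | f y = g y]°); split.
- exact: openI oA (open_interior _).
- by split => //; exact: fg.
move=> k; apply: (@Ck_eq _ _ _ _ _ f).
- exact: openI oA (open_interior _).
- by move=> y [_ /interior_subset].
- by apply: Ck_sub (sf k) => y [].
Qed.

Lemma near_smooth f x : smooth_near f x -> \forall y \near x, smooth_near f y.
Proof. by move=> [A [oA Ax sf]]; apply: (open_near oA Ax) => y Ay; exists A. Qed.

Lemma smooth_near_differentiable f x : smooth_near f x -> differentiable f x.
Proof. by move=> [A [oA Ax /(_ 1%N) [df _]]]; exact: df. Qed.

Lemma smooth_near_cst (a : W) x : smooth_near (fun=> a) x.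
Proof. by exists setT; split=> // [|k]; [exact: openT|exact: Ck_cst]. Qed.

Lemma smooth_near_add f g x : smooth_near f x -> smooth_near g x ->
  smooth_near (fun y => f y + g y) x.
Proof.
move=> [A [oA Ax sf]] [B [oB Bx sg]]; exists (A `&` B); split=> //.
  exact: openI.
by move=> k; apply: Ck_add; [exact: openI|apply: Ck_sub (sf k)|
  apply: Ck_sub (sg k)] => y [].
Qed.

End Generic.

Lemma smooth_near_id (V : normedModType R) (x : V) : smooth_near (@id V) x.
Proof.
exists setT; split=> // [|[|k]]; first exact: openT.
  by move=> y _; exact: cvg_id.
split=> [y _|v]; first by have [] := is_diff_id y.
rewrite (_ : 'D_v id = fun=> v); first exact: Ck_cst.
by apply/funext => y; rewrite derive_id.
Qed.

Lemma smooth_near_scale (V W : normedModType R) (h : V -> R^o) (f : V -> W) x :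
  smooth_near h x -> smooth_near f x -> smooth_near (fun y => h y *: f y) x.
Proof.
move=> [A [oA Ax sf]] [B [oB Bx sg]]; exists (A `&` B); split=> //.
  exact: openI.
by move=> k; apply: Ck_scale; [exact: openI|apply: Ck_sub (sf k)|
  apply: Ck_sub (sg k)] => y [].
Qed.

Section RowVectors.
Variables (n : nat) (V Z : normedModType R).
Implicit Types (F : 'rV[R]_n -> Z) (psi v : V -> 'rV[R]_n) (x : V).

Lemma smooth_near_comp_set F psi x : smooth_near F (psi x) -> smooth_near psi x ->
  exists A B, [/\ open A, A x, (forall y, A y -> B (psi y)),
    smooth_on B F & smooth_on A psi].
Proof.
move=> [B [oB Bx sF]] [A [oA Ax sp]].
have cp y : A y -> {for y, continuous psi} by move: (sp 0%N); apply.
exists (A `&` psi @^-1` B), B; split=> //.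
- rewrite openE => y [Ay By]; apply: filterI; first exact: open_nbhs_nbhs.
  by apply: (cp y Ay); exact: open_nbhs_nbhs.
- by move=> y [].
- by move=> k; apply: Ck_sub (sp k) => y [].
Qed.

Lemma smooth_near_comp F psi x : smooth_near F (psi x) -> smooth_near psi x ->
  smooth_near (F \o psi) x.
Proof.
move=> sF sp; have [A [B [oA Ax AB cF cp]]] := smooth_near_comp_set sF sp.
by exists A; split=> // k; exact: Ck_comp (cF k) (cp k).
Qed.

Lemma smooth_near_diff_apply F psi v x :
  smooth_near F (psi x) -> smooth_near psi x -> smooth_near v x ->
  smooth_near (fun y => 'd F (psi y) (v y)) x.
Proof.
move=> sF sp [C [oC Cx cv]].
have [A [B [oA Ax AB cF cp]]] := smooth_near_comp_set sF sp.
have oAC : open (A `&` C) by exact: openI.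
exists (A `&` C); split=> // k; apply: Ck_diff_apply => //.
- by move=> y [/AB By _]; have [dF _] := cF 1%N; exact: dF.
- move=> j; apply: (@Ck_comp _ _ _ _ _ _ B) => //.
  + by move=> y [/AB].
  + by have [_ dF] := cF k.+1; exact: dF.
  + by apply: Ck_sub (cp k) => y [].
- by apply: Ck_sub (cv k) => y [].
Qed.

End RowVectors.
End SmoothGerms.

(** * The commutator of two vector fields in coordinates *)

Section Commutator.
Variables (R : realType) (n : nat).

Lemma is_diff_sum (V W : normedModType R) m (f df : 'I_m -> V -> W) x :
  (forall i, is_diff x (f i) (df i)) ->
  is_diff x (fun y => \sum_i f i y) (fun v => \sum_i df i v).
Proof.
move=> dfi.
rewrite (_ : (fun y => _) = \sum_i f i); last first.
  by rewrite funeqE => y; rewrite fct_sumE.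
rewrite (_ : (fun v => _) = \sum_i df i); last first.
  by rewrite funeqE => y; rewrite fct_sumE.
elim/big_ind2 : _ => [||i _]; last exact: dfi.
- exact: is_diff_cst.
- by move=> f1 df1 f2 df2 d1 d2; exact: is_diffD.
Qed.

Variable Z : normedModType R.
Implicit Types (F : 'rV[R]_n -> Z) (Y : 'rV[R]_n -> 'rV[R]_n).
Implicit Types (x u : 'rV[R]_n).

(** The product rule for the expansion of ['d F y (Y y)] in the standard
    basis. *)
Lemma diff_diff_apply_sum F Y x u : smooth_near F x -> smooth_near Y x ->
  'd (fun y => 'd F y (Y y)) x u =
  \sum_j (Y x 0 j *: 'd ('D_(delta_mx 0 j) F) x u) + 'd F x ('d Y x u).
Proof.
move=> sF sY; have dY := smooth_near_differentiable sY.
have dF : differentiable F x := smooth_near_differentiable sF.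
have dDF j : differentiable ('D_(delta_mx 0 j) F) x.
  have [A [_ Ax /(_ 2%N) [_ d2F]]] := sF.
  by have [d _] := d2F (delta_mx 0 j); exact: d.
have dYj j : is_diff x (row_coord j \o Y) (row_coord j \o 'd Y x).
  have dr : differentiable (row_coord j) (Y x).
    exact/linear_differentiable/continuous_row_coord.
  split; first exact: differentiable_comp.
  by rewrite diff_comp// diff_lin//; exact: continuous_row_coord.
pose G y := \sum_j (row_coord j \o Y) y *: 'D_(delta_mx 0 j) F y.
have nG : {near x, G =1 fun y => 'd F y (Y y)}.
  have := near_smooth sF; apply: filterS => y sFy.
  have dFy := smooth_near_differentiable sFy.
  rewrite /G [in RHS](row_sum_delta (Y y)) linear_sum.
  by apply: eq_bigr => j _; rewrite linearZ /= deriveE.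
have dG := is_diff_sum (fun j =>
  is_diff_scale (@ex_diff _ _ _ _ _ _ _ (dYj j)) (dDF j)).
have [dfG vG] := dG; have dGY := etrans (near_eq_diff nG dfG) vG.
apply: etrans (congr1 (@^~ u) dGY) _; rewrite big_split /=; congr (_ + _).
rewrite [X in 'd F x X](row_sum_delta ('d Y x u)) linear_sum.
apply: eq_bigr => j _; rewrite linearZ /= (@diff_val _ _ _ _ _ _ _ (dYj j)) /=.
by rewrite deriveE.
Qed.

(** The sum over the basis is recognised as a second derivative by comparison
    with the constant field [Y x]. *)
Lemma diff_diff_apply F Y x u : smooth_near F x -> smooth_near Y x ->
  'd (fun y => 'd F y (Y y)) x u =
  'D_u ('D_(Y x) F) x + 'd F x ('d Y x u).
Proof.
move=> sF sY; rewrite (diff_diff_apply_sum u sF sY); congr (_ + _).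
have sc : smooth_near (fun=> Y x : 'rV[R]_n) x by exact: smooth_near_cst.
have c0 : 'd (fun=> Y x : 'rV[R]_n) x u = 0.
  by rewrite -[LHS]/('d (cst (Y x)) x u) (diff_cst (Y x) x).
have d0 : 'd F x ('d (fun=> Y x : 'rV[R]_n) x u) = 0.
  exact: etrans (congr1 ('d F x) c0) (linear0 _).
have e := etrans (diff_diff_apply_sum u sF sc) (congr1 (+%R _) d0).
rewrite -[LHS]addr0; apply: etrans (esym e) _.
have nd : {near x, 'D_(Y x) F =1 (fun y => 'd F y (Y x))}.
  have := near_smooth sF; apply: filterS => y sFy.
  by rewrite deriveE//; exact: smooth_near_differentiable.
have [A [_ Ax /(_ 2%N) [_ d2F]]] := sF; have [/(_ x Ax) d _] := d2F (Y x).
by rewrite (near_eq_diff nd)// deriveE.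
Qed.

End Commutator.

(** The second-order terms of X(Y F) and Y(X F) are the two mixed derivatives of
    [F], so they cancel. *)
Lemma diff_commutator (R : realType) (n : nat) (F : 'rV[R]_n -> R^o)
    (X Y : 'rV[R]_n -> 'rV[R]_n) x :
  smooth_near F x -> smooth_near X x -> smooth_near Y x ->
  'd (fun y => 'd F y (Y y)) x (X x) - 'd (fun y => 'd F y (X y)) x (Y x)
  = 'd F x ('d Y x (X x) - 'd X x (Y x)).
Proof.
move=> sF sX sY; have [A [oA Ax cF]] := sF.
have eY := diff_diff_apply (X x) sF sY.
have eX := diff_diff_apply (Y x) sF sX.
apply: etrans (congr2 (fun a b : R => a - b) eY eX) _.
apply: etrans _ (esym (linearB ('d F x) _ _)).
have cancel (c c' a b : R) : c = c' -> c + a - (c' + b) = a - b.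
  by move=> ->; ring.
exact: cancel (derive_comm _ _ oA Ax (cF 2%N)).
Qed.

(** * Charts and tangent vectors *)

Section Charts.
Variables (R : realType) (n : nat) (M : topologicalType).
Implicit Types (c d : chart R n M) (p q r : M).

Lemma near_cdom c r : cdom c r -> \forall q \near r, cdom c q.
Proof. by move=> cr; apply: open_nbhs_nbhs; split=> //; exact: cdom_open. Qed.

Lemma near_cinv c r (Q : M -> Prop) : cdom c r ->
  (\forall q \near r, Q q) -> \forall x \near cmap c r, Q (cinv c x).
Proof.
move=> cr Qr; have im : (cmap c @` cdom c) (cmap c r) by exists r.
have cont := cinv_continuous im.
by apply: cont; rewrite (cmapK cr).
Qed.

Lemma near_cmap c r (Q : 'rV[R]_n -> Prop) : cdom c r ->
  (\forall x \near cmap c r, Q x) -> \forall q \near r, Q (cmap c q).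
Proof. by move=> cr Qr; exact: (cmap_continuous cr). Qed.

Lemma near_cimg c r : cdom c r -> \forall x \near cmap c r,
  cdom c (cinv c x) /\ cmap c (cinv c x) = x.
Proof.
move=> cr; have : nbhs (cmap c r) (cmap c @` cdom c).
  by apply: open_nbhs_nbhs; split; [exact: cimg_open|exists r].
by apply: filterS => _ [q cq <-]; rewrite cmapK.
Qed.

(** The image of an overlap is open because [cinv] is continuous on the image of
    the chart. *)
Lemma open_overlap c d : open (cmap c @` (cdom c `&` cdom d)).
Proof.
rewrite openE => _ [r [cr dr] <-]; rewrite /interior.
apply: filterS2 (near_cimg cr) (near_cinv cr (near_cdom dr)) => x [cx e] dx.
by exists (cinv c x).
Qed.

Lemma smooth_transition c d r : compatible c d -> cdom c r -> cdom d r ->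
  smooth_near (transition c d) (cmap c r).
Proof.
move=> [sm _] cr dr; exists (cmap c @` (cdom c `&` cdom d)); split=> //.
  exact: open_overlap.
by exists r.
Qed.

Lemma transitionE c d r : cdom c r -> transition c d (cmap c r) = cmap d r.
Proof. by move=> cr; rewrite /transition /= cmapK. Qed.

Lemma near_comp_transition T (f : M -> T) c d r : cdom c r -> cdom d r ->
  {near cmap c r, (f \o cinv d) \o transition c d =1 f \o cinv c}.
Proof.
move=> cr dr; apply: filterS (near_cinv cr (near_cdom dr)) => x dx.
by rewrite /transition /= (cmapK dx).
Qed.

(** Functoriality of components of tangent vectors, that is, the chain rule for
    transition maps, which compose near the point. *)
Lemma tangent_change_comp a c d r v :
  compatible a c -> compatible c d -> cdom a r -> cdom c r -> cdom d r ->
  tangent_change c d r (tangent_change a c r v) = tangent_change a d r v.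
Proof.
move=> ac cd ar cr dr; rewrite /tangent_change.
have dac := smooth_near_differentiable (smooth_transition ac ar cr).
have := smooth_near_differentiable (smooth_transition cd cr dr).
rewrite -(transitionE c ar) => dcd.
have e : {near cmap a r, transition c d \o transition a c =1 transition a d}.
  exact: near_comp_transition.
have e1 := near_eq_diff e (differentiable_comp dac dcd).
have de := etrans e1 (diff_comp dac dcd).
exact: esym (congr1 (@^~ v) de).
Qed.

Lemma tangent_change_id c r v : cdom c r -> tangent_change c c r v = v.
Proof.
move=> cr; rewrite /tangent_change.
have e : {near cmap c r, id =1 transition c c}.
  by apply: filterS (near_cimg cr) => x [_ ex]; rewrite /transition /= ex.
have [did vid] := is_diff_id (cmap c r).
have de := etrans (near_eq_diff e did) vid.
by have := congr1 (@^~ v) de.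
Qed.

End Charts.

(** * Smooth functions and vector fields *)

Section SmoothTensors.
Variables (R : realType) (n : nat) (M : topologicalType).
Variable S : smooth_manifold R n M.
Implicit Types (X Y Z : field R n M) (f h : M -> R) (p q r : M).

Local Notation chart_at := (chart_at S).
Local Notation mem_chart_at := (mem_chart_at S).
Local Notation compat := (chart_at_compatible S).

Lemma field_in_chart_cmap c X r : cdom c r ->
  field_in_chart S c X (cmap c r) = tangent_change (chart_at r) c r (X r).
Proof. by move=> cr; rewrite /field_in_chart cmapK. Qed.

Lemma field_in_chart_at X p :
  field_in_chart S (chart_at p) X (cmap (chart_at p) p) = X p.
Proof.
by rewrite field_in_chart_cmap ?tangent_change_id//; exact: mem_chart_at.
Qed.

Lemma field_in_chart_change p q X r : cdom (chart_at p) r -> cdom (chart_at q) r ->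
  field_in_chart S (chart_at q) X (cmap (chart_at q) r) =
  tangent_change (chart_at p) (chart_at q) r
    (field_in_chart S (chart_at p) X (cmap (chart_at p) r)).
Proof.
move=> pr qr; rewrite !field_in_chart_cmap// tangent_change_comp//.
- exact: compat.
- exact: compat.
- exact: mem_chart_at.
Qed.

Lemma smooth_fun_at_eq f h p : {near p, f =1 h} ->
  smooth_fun_at S f p -> smooth_fun_at S h p.
Proof.
move=> fh; apply: smooth_near_eq.
exact: (near_cinv (mem_chart_at p) fh).
Qed.

Lemma smooth_fun_at_cst (a : R) p : smooth_fun_at S (fun=> a) p.
Proof. exact: smooth_near_cst. Qed.

Lemma smooth_field_at_eq X Y p : {near p, X =1 Y} ->
  smooth_field_at S X p -> smooth_field_at S Y p.
Proof.
move=> XY; apply: smooth_near_eq.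
apply: filterS (near_cinv (mem_chart_at p) XY) => x e.
by rewrite /field_in_chart e.
Qed.

Lemma smooth_field_at0 p : smooth_field_at S (fun=> 0) p.
Proof.
apply: smooth_near_eq (smooth_near_cst 0 _).
by near=> x; rewrite /field_in_chart /tangent_change linear0.
Unshelve. all: by end_near. Qed.

Lemma smooth_field_atD X Y p : smooth_field_at S X p -> smooth_field_at S Y p ->
  smooth_field_at S (fun q => X q + Y q) p.
Proof.
move=> sX sY; apply: smooth_near_eq (smooth_near_add sX sY).
by near=> x; rewrite /field_in_chart /tangent_change linearD.
Unshelve. all: by end_near. Qed.

Lemma smooth_field_atZ f X p : smooth_fun_at S f p -> smooth_field_at S X p ->
  smooth_field_at S (fun q => f q *: X q) p.
Proof.
move=> sf sX; apply: smooth_near_eq (smooth_near_scale sf sX).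
by near=> x; rewrite /field_in_chart /tangent_change linearZ.
Unshelve. all: by end_near. Qed.

Lemma smooth_field_atN X p : smooth_field_at S X p ->
  smooth_field_at S (fun q => - X q) p.
Proof.
move=> sX; have s1 := smooth_field_atZ (smooth_fun_at_cst (-1) p) sX.
apply: smooth_field_at_eq s1.
by near=> q; rewrite scaleN1r.
Unshelve. all: by end_near. Qed.

(** The components in the chart at [q] are those in the chart at [p], composed
    with one transition map and transported by the differential of the other;
    smooth maps are stable under both operations. *)
Lemma smooth_in_chart_field X p q : cdom (chart_at p) q ->
  smooth_near (field_in_chart S (chart_at p) X) (cmap (chart_at p) q) ->
  smooth_field_at S X q.
Proof.
move=> pq sX; have qq := mem_chart_at q.
have st := smooth_transition (compat q p) qq pq.
have st' := smooth_transition (compat p q) pq qq.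
rewrite -(transitionE (chart_at p) qq) in st'.
have sX' : smooth_near (field_in_chart S (chart_at p) X
    \o transition (chart_at q) (chart_at p)) (cmap (chart_at q) q).
  by apply: smooth_near_comp st; rewrite transitionE.
apply: smooth_near_eq (smooth_near_diff_apply st' st sX').
apply: filterS2 (near_cimg qq) (near_cinv qq (near_cdom pq)) => x [qx e] px.
rewrite -e (field_in_chart_change _ px qx) /tangent_change /=.
by rewrite !transitionE.
Qed.

(** Smoothness in the chart at [p] is open, and it is smoothness at each nearby
    point by [smooth_in_chart_field]; this allows pointwise identities between
    smooth fields to be differentiated. *)
Lemma near_smooth_field X p : smooth_field_at S X p ->
  \forall q \near p, smooth_field_at S X q.
Proof.
move=> /near_smooth /(near_cmap (mem_chart_at p)).
by apply: filterS2 (near_cdom (mem_chart_at p)) => q; exact: smooth_in_chart_field.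
Qed.

(** The components in the chart at [p] are constant because changing charts back
    and forth is the identity. *)
Lemma smooth_constant_field p v :
  smooth_field_at S (constant_field S (chart_at p) v) p.
Proof.
have pp := mem_chart_at p.
apply: smooth_near_eq (smooth_near_cst v _).
apply: filterS (near_cimg pp) => x [px e].
rewrite -e field_in_chart_cmap// /constant_field tangent_change_comp//.
- by rewrite tangent_change_id.
- exact: compat.
- exact: compat.
- exact: mem_chart_at.
Qed.

Lemma constant_field_at p v : constant_field S (chart_at p) v p = v.
Proof. by rewrite /constant_field tangent_change_id//; exact: mem_chart_at. Qed.

(** A derivation, computed at each point in the preferred chart of that point,
    can be computed near [p] in the single chart at [p]; only then can it be
    differentiated again. *)
Lemma derivation_chart p X f q : cdom (chart_at p) q ->
  differentiable (f \o cinv (chart_at p) : 'rV[R]_n -> R^o) (cmap (chart_at p) q) ->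
  derivation S X f q =
  'd (f \o cinv (chart_at p) : 'rV[R]_n -> R^o) (cmap (chart_at p) q)
    (field_in_chart S (chart_at p) X (cmap (chart_at p) q)).
Proof.
move=> pq; have qq := mem_chart_at q.
have dt := smooth_near_differentiable (smooth_transition (compat q p) qq pq).
rewrite field_in_chart_cmap// -(transitionE (chart_at p) qq) => df.
have e := near_comp_transition f qq pq.
have de := etrans (near_eq_diff e (differentiable_comp dt df)) (diff_comp dt df).
by have := congr1 (@^~ (X q)) de.
Qed.

Lemma derivation_near_eq X f h p : {near p, f =1 h} -> smooth_fun_at S f p ->
  derivation S X f p = derivation S X h p.
Proof.
move=> fh sf; have e := near_cinv (mem_chart_at p) fh.
exact: esym (congr1 (@^~ (X p)) (near_eq_diff e (smooth_near_differentiable sf))).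
Qed.

Lemma derivation_cst X (a : R) p : derivation S X (fun=> a) p = 0.
Proof.
rewrite /derivation; have d0 := diff_cst (a : R^o) (cmap (chart_at p) p).
by have := congr1 (@^~ (X p)) d0.
Qed.

Lemma derivationD X f h p : smooth_fun_at S f p -> smooth_fun_at S h p ->
  derivation S X (fun q => f q + h q) p = derivation S X f p + derivation S X h p.
Proof.
move=> /smooth_near_differentiable df /smooth_near_differentiable dh.
by have := congr1 (@^~ (X p)) (diffD df dh).
Qed.

(** Near [p] both inner derivations are read in the chart at [p], where the
    identity is [diff_commutator]. *)
Lemma derivation_commutator X Y f p :
  smooth_field_at S X p -> smooth_field_at S Y p -> smooth_fun_at S f p ->
  derivation S X (derivation S Y f) p - derivation S Y (derivation S X f) p
  = derivation S (lie_bracket S X Y) f p.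
Proof.
move=> sX sY sf; have pp := mem_chart_at p.
have key A B : smooth_field_at S B p ->
  derivation S A (derivation S B f) p =
  'd (fun x => 'd (f \o cinv (chart_at p) : 'rV[R]_n -> R^o) x
      (field_in_chart S (chart_at p) B x) : R^o) (cmap (chart_at p) p)
    (field_in_chart S (chart_at p) A (cmap (chart_at p) p)).
  set G := fun x => _; move=> sB; rewrite field_in_chart_at.
  have nG : {near cmap (chart_at p) p, G =1 derivation S B f \o cinv (chart_at p)}.
    apply: filterS2 (near_cimg pp) (near_smooth sf) => x [px e] sfx.
    have := @derivation_chart p B f (cinv (chart_at p) x) px.
    by rewrite e => /(_ (smooth_near_differentiable sfx)) /esym.
  have dG : differentiable G (cmap (chart_at p) p).
    apply: smooth_near_differentiable.
    by apply: smooth_near_diff_apply sB => //; exact: smooth_near_id.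
  by have := congr1 (@^~ (A p)) (near_eq_diff nG dG).
rewrite (key X Y sY) (key Y X sX).
apply: etrans (diff_commutator sf sX sY) _.
by rewrite /derivation /lie_bracket !field_in_chart_at.
Qed.

End SmoothTensors.

(** * The bilinear form of a Gram matrix *)

Section BilinearForm.
Variables (R : realType) (n : nat) (G : 'M[R]_n).
Implicit Types (u v w : 'rV[R]_n) (a : R).

Definition form u v : R := (u *m G *m v^T) 0 0.

Lemma formDl u u' v : form (u + u') v = form u v + form u' v.
Proof. by rewrite /form !mulmxDl mxE. Qed.

Lemma formNl u v : form (- u) v = - form u v.
Proof. by rewrite /form !mulNmx mxE. Qed.

Lemma formZl a u v : form (a *: u) v = a * form u v.
Proof. by rewrite /form -!scalemxAl mxE. Qed.

Lemma formDr u v v' : form u (v + v') = form u v + form u v'.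
Proof. by rewrite /form linearD mulmxDr mxE. Qed.

Lemma formNr u v : form u (- v) = - form u v.
Proof. by rewrite /form linearN mulmxN mxE. Qed.

Lemma formZr a u v : form u (a *: v) = a * form u v.
Proof. by rewrite /form linearZ -scalemxAr mxE. Qed.

Lemma form0l v : form 0 v = 0.
Proof. by rewrite /form !mul0mx mxE. Qed.

Lemma form0r u : form u 0 = 0.
Proof. by rewrite /form trmx0 mulmx0 mxE. Qed.

(** The trace of the rank one map sending [w] to [form w v *: u]. *)
Lemma form_sum_delta u v : \sum_i u 0 i * form (delta_mx 0 i) v = form u v.
Proof.
rewrite [u in RHS]row_sum_delta /form !mulmx_suml summxE.
by apply: eq_bigr => i _; rewrite -!scalemxAl [RHS]mxE.
Qed.

Lemma form_sym u v : G^T = G -> form u v = form v u.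
Proof.
move=> sG; rewrite /form.
have -> : v *m G *m u^T = (u *m G *m v^T)^T by rewrite !trmx_mul trmxK sG mulmxA.
by rewrite [RHS]mxE.
Qed.

Definition formE := (formDl, formDr, formNl, formNr, formZl, formZr).

End BilinearForm.

(** * Curvature of metric connections *)

Section Connections.
Variables (R : realType) (n : nat) (M : topologicalType).
Variable S : smooth_manifold R n M.
Variable g : M -> 'M[R]_n.
Implicit Types (X Y Z U V : field R n M) (p q : M).
Local Notation smooth := (smooth_field_at S).

Lemma metricE X Y p : metric g X Y p = form (g p) (X p) (Y p).
Proof. by []. Qed.

Section MetricConnection.
Hypothesis g_smooth : forall p X Y, smooth X p -> smooth Y p ->
  smooth_fun_at S (metric g X Y) p.
Variable D : field R n M -> field R n M -> field R n M.
Hypothesis D_smooth : forall p X Y, smooth X p -> smooth Y p -> smooth (D X Y) p.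
Hypothesis D_metric : forall p X Y Z, smooth X p -> smooth Y p -> smooth Z p ->
  derivation S X (metric g Y Z) p = metric g (D X Y) Z p + metric g Y (D X Z) p.

(** Metricity holds near [p], so it may be differentiated once more. *)
Lemma derivation2_metric p X Y U V :
  smooth X p -> smooth Y p -> smooth U p -> smooth V p ->
  derivation S X (derivation S Y (metric g U V)) p =
  metric g (D X (D Y U)) V p + metric g (D Y U) (D X V) p
  + (metric g (D X U) (D Y V) p + metric g U (D X (D Y V)) p).
Proof.
move=> sX sY sU sV.
have e : {near p, (fun q => metric g (D Y U) V q + metric g U (D Y V) q)
                  =1 derivation S Y (metric g U V)}.
  apply: filterS3 (near_smooth_field sY) (near_smooth_field sU)
    (near_smooth_field sV) => q sYq sUq sVq.
  by rewrite D_metric.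
have s1 : smooth_fun_at S (metric g (D Y U) V) p by apply/g_smooth/sV/D_smooth.
have s2 : smooth_fun_at S (metric g U (D Y V)) p by apply/g_smooth/D_smooth.
rewrite -(derivation_near_eq X e (smooth_near_add s1 s2)) derivationD//.
by rewrite !D_metric//; exact: D_smooth.
Qed.

(** The operator X Y - Y X - [X, Y] kills the function g(U, V). Expanding by
    metricity, the products of first covariant derivatives are symmetric in X
    and Y, and what remains is the two curvature terms. *)
Lemma curvature_skew p X Y U V : smooth (lie_bracket S X Y) p ->
  smooth X p -> smooth Y p -> smooth U p -> smooth V p ->
  metric g (curvature S D X Y U) V p + metric g U (curvature S D X Y V) p = 0.
Proof.
move=> sB sX sY sU sV.
have := derivation_commutator sX sY (g_smooth sU sV).
rewrite !derivation2_metric// D_metric//.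
rewrite !metricE /curvature !formE => /eqP; rewrite -subr_eq0 => /eqP <-.
by ring.
Qed.

End MetricConnection.

Section Connection.
Variable D : field R n M -> field R n M -> field R n M.
Hypothesis hD : connection S D.

(** A connection is local: [Z] equals [f *: Z] for the function [f] that is 1
    where [Z] is nonzero and 0 elsewhere. When [Z] vanishes near [p], so does
    [f], which is therefore smooth there, and the Leibniz rule gives 0. *)
Lemma nabla_near0 p X Z : smooth X p -> {near p, Z =1 fun=> 0} -> D X Z p = 0.
Proof.
move=> sX Z0.
have sZ : smooth Z p.
  by apply: smooth_field_at_eq (smooth_field_at0 S p); apply: filterS Z0 => q ->.
pose f q : R := (Z q != 0)%:R.
have f0 : {near p, (fun=> 0) =1 f}.
  by apply: filterS Z0 => q; rewrite /f => ->; rewrite eqxx.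
have sf : smooth_fun_at S f p.
  exact: smooth_fun_at_eq f0 (smooth_fun_at_cst S 0 p).
have e : (fun q => f q *: Z q) = Z.
  apply/funext => q; rewrite /f.
  by case: eqVneq => [->|_]; rewrite ?scaler0 ?scale1r.
rewrite -e (nabla_leibniz hD sf sX sZ) (nbhs_singleton Z0) scaler0 add0r.
by rewrite -(nbhs_singleton f0) scale0r.
Qed.

Lemma nablaBr p X Y Z : smooth X p -> smooth Y p -> smooth Z p ->
  D X (fun q => Y q - Z q) p = D X Y p - D X Z p.
Proof.
move=> sX sY sZ; rewrite (nablaDr hD sX sY (smooth_field_atN sZ)); congr (_ + _).
rewrite (_ : (fun q => - Z q) = (fun q => (fun=> -1 : R) q *: Z q)); last first.
  by apply/funext => q; rewrite scaleN1r.
rewrite (nabla_leibniz hD (smooth_fun_at_cst S (-1) p) sX sZ) derivation_cst.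
by rewrite scale0r add0r scaleN1r.
Qed.

End Connection.

Lemma ricci_sum (D : field R n M -> field R n M -> field R n M) Y Z p :
  ricci S D Y Z p =
  \sum_i curvature S D (constant_field S (chart_at S p) (delta_mx 0 i)) Y Z p 0 i.
Proof. by apply: eq_bigr => i _; rewrite mxE. Qed.

(** * The semi-symmetric connection *)

Section SemiSymmetric.
Hypothesis hg : lorentzian_metric S g.
Variable nabla : field R n M -> field R n M -> field R n M.
Hypothesis hnabla : levi_civita S g nabla.
Variable P : field R n M.
Hypothesis P_smooth : forall p, smooth P p.

Local Notation D := nabla.
Local Notation E := (semi_symmetric_connection g P nabla).
Let hD : connection S D := levi_civita_connection hnabla.
Let g_smooth := metric_smooth hg.
Let gC u v p : form (g p) u v = form (g p) v u.
Proof. exact/form_sym/(metric_symmetric hg). Qed.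

(** Torsion-freeness near [p] writes the bracket as a difference of covariant
    derivatives. *)
Lemma smooth_lie_bracket p X Y : smooth X p -> smooth Y p ->
  smooth (lie_bracket S X Y) p.
Proof.
move=> sX sY.
apply: (@smooth_field_at_eq _ _ _ _ (fun q => D X Y q - D Y X q)).
  apply: filterS2 (near_smooth_field sX) (near_smooth_field sY) => q.
  exact: (levi_civita_torsion_free hnabla).
by apply: smooth_field_atD; [|apply: smooth_field_atN]; exact: (nabla_smooth hD).
Qed.

Lemma semi_symmetric_smooth p X Y : smooth X p -> smooth Y p -> smooth (E X Y) p.
Proof.
move=> sX sY; apply: smooth_field_atD; last first.
  by apply: smooth_field_atN; apply: smooth_field_atZ => //; exact: g_smooth.
apply: smooth_field_atD; first exact: (nabla_smooth hD).
by apply: smooth_field_atZ => //; exact: g_smooth.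
Qed.

(** The map sending [Z] to g(Z, P) X - g(X, Z) P is skew-adjoint, so adding it to
    the Levi-Civita derivative preserves metricity. *)
Lemma semi_symmetric_metric p X Y Z : smooth X p -> smooth Y p -> smooth Z p ->
  derivation S X (metric g Y Z) p = metric g (E X Y) Z p + metric g Y (E X Z) p.
Proof.
move=> sX sY sZ; rewrite (levi_civita_metric hnabla)//.
rewrite !metricE /semi_symmetric_connection !formE !metricE.
by rewrite (gC (Y p) (X p)) (gC (P p) (Z p)); ring.
Qed.

Lemma smooth_curvature p X Y Z : smooth X p -> smooth Y p -> smooth Z p ->
  smooth (curvature S E X Y Z) p.
Proof.
move=> sX sY sZ.
have sXYZ := semi_symmetric_smooth sX (semi_symmetric_smooth sY sZ).
have sYXZ := semi_symmetric_smooth sY (semi_symmetric_smooth sX sZ).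
have sBZ := semi_symmetric_smooth (smooth_lie_bracket sX sY) sZ.
have sD := smooth_field_atD sXYZ (smooth_field_atN sYXZ).
exact: smooth_field_atD sD (smooth_field_atN sBZ).
Qed.

Lemma nabla_semi_symmetric p X Y Z : smooth X p -> smooth Y p -> smooth Z p ->
  D X (E Y Z) p = D X (D Y Z) p
    + (derivation S X (metric g Z P) p *: Y p + metric g Z P p *: D X Y p)
    - (derivation S X (metric g Y Z) p *: P p + metric g Y Z p *: D X P p).
Proof.
move=> sX sY sZ.
have sDYZ : smooth (D Y Z) p by exact: (nabla_smooth hD).
have sZP : smooth_fun_at S (metric g Z P) p by exact: g_smooth.
have sYZ : smooth_fun_at S (metric g Y Z) p by exact: g_smooth.
have s1 : smooth (fun q => metric g Z P q *: Y q) p by exact: smooth_field_atZ.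
have s2 : smooth (fun q => metric g Y Z q *: P q) p by exact: smooth_field_atZ.
rewrite (nablaBr hD sX (smooth_field_atD sDYZ s1) s2) (nablaDr hD sX sDYZ s1).
by rewrite (nabla_leibniz hD sZP sX sY) (nabla_leibniz hD sYZ sX (P_smooth p)).
Qed.

Hypothesis P_unit : unit_timelike g P.
Hypothesis P_parallel : parallel S E P.

(** This is E P = 0 solved for D P, using g(P, P) = -1. *)
Lemma nabla_P p X : smooth X p -> D X P p = X p + metric g X P p *: P p.
Proof.
move=> sX; have := P_parallel sX; rewrite /semi_symmetric_connection P_unit.
by rewrite scaleN1r => /eqP; rewrite subr_eq0 subr_eq => /eqP ->; rewrite addrC.
Qed.

(** P is E-parallel near [p], so each of the three terms vanishes. *)
Lemma curvature_P p X Y : smooth X p -> smooth Y p -> curvature S E X Y P p = 0.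
Proof.
move=> sX sY; have sB := smooth_lie_bracket sX sY.
have E2 A B : smooth A p -> smooth B p -> E A (E B P) p = 0.
  move=> sA sB'; have EBP : {near p, E B P =1 fun=> 0}.
    by apply: filterS (near_smooth_field sB') => q; exact: P_parallel.
  rewrite /semi_symmetric_connection -/(E B P) (nabla_near0 hD sA EBP).
  rewrite !metricE (nbhs_singleton EBP) form0l form0r !scale0r.
  by rewrite !addr0 subr0.
by rewrite /curvature !E2// (P_parallel sB) !subr0.
Qed.

(** Expand both derivatives, replace derivatives of g by metricity, D P by
    [nabla_P] and the bracket by torsion-freeness: an identity between
    coordinates remains. *)
Lemma curvature_semi_symmetric p X Y Z : smooth X p -> smooth Y p -> smooth Z p ->
  curvature S E X Y Z p = curvature S D X Y Z p
    - (metric g Y Z p *: X p - metric g X Z p *: Y p).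
Proof.
move=> sX sY sZ; have sP := P_smooth p.
rewrite /curvature.
have EE A B :
  E A B p = D A B p + metric g B P p *: A p - metric g A B p *: P p by [].
rewrite (EE X (E Y Z)) (EE Y (E X Z)) (EE (lie_bracket S X Y) Z).
rewrite !nabla_semi_symmetric// !(levi_civita_metric hnabla)// !metricE.
rewrite !EE !nabla_P// -(levi_civita_torsion_free hnabla sX sY) !metricE !formE.
have := P_unit p; rewrite metricE => ->.
apply/rowP => i; rewrite !mxE.
(* Each value of the symmetric form must occur in one order only. *)
rewrite (gC (Y p) (X p)) (gC (Z p) (X p)) (gC (Z p) (Y p)).
rewrite (gC (X p) (D Y Z p)) (gC (Y p) (D X Z p)).
by ring.
Qed.

(** Tracing over X, the term g(Y, Z) X contributes n g(Y, Z) and the term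
    g(X, Z) Y contributes g(Y, Z). *)
Lemma ricci_semi_symmetric p Y Z : smooth Y p -> smooth Z p ->
  ricci S E Y Z p = ricci S D Y Z p - (n%:R - 1) * metric g Y Z p.
Proof.
move=> sY sZ; rewrite !ricci_sum.
have term i : let e := constant_field S (chart_at S p) (delta_mx 0 i) in
  curvature S E e Y Z p 0 i = curvature S D e Y Z p 0 i
    - (metric g Y Z p - Y p 0 i * form (g p) (delta_mx 0 i) (Z p)).
  rewrite /= (curvature_semi_symmetric (smooth_constant_field _ _ _) sY sZ).
  rewrite [metric g (constant_field _ _ _) Z p]metricE constant_field_at.
  set K := curvature _ _ _ _ _ p; rewrite !mxE !eqxx mulr1.
  by rewrite [_ * Y p 0 i]mulrC.
rewrite (eq_bigr _ (fun i _ => term i)) sumrB sumrB form_sum_delta.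
by rewrite sumr_const card_ord -metricE -mulr_natr; ring.
Qed.

Hypothesis fluid : perfect_fluid S g P D.

(** Evaluating on (P, P), where Ric_E vanishes by [curvature_P], determines the
    coefficient of g from that of pi (x) pi. *)
Lemma ricci_fluid p : exists b : R, forall Y Z, smooth Y p -> smooth Z p ->
  ricci S E Y Z p = b * (metric g Y Z p + metric g Y P p * metric g Z P p).
Proof.
have [a [b ab]] := fluid; exists (b p) => Y Z sY sZ.
have sP := P_smooth p.
have : ricci S E P P p = 0.
  rewrite ricci_sum big1// => i _.
  by rewrite (curvature_P (smooth_constant_field _ _ _) sP) mxE.
rewrite !ricci_semi_symmetric// !ab// P_unit => /eqP.
set c := n%:R - 1.
have -> : a p * -1 + b p * (-1 * -1) - c * -1 = b p + c - a p by ring.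
by rewrite subr_eq0 => /eqP <-; ring.
Qed.

End SemiSymmetric.
End Connections.

Theorem corollary5p1 (R : realType) (n : nat) (hn : (3 <= n)%N)
  (M : topologicalType) (S : smooth_manifold R n M)
  (g : M -> 'M[R]_n) (hg : lorentzian_metric S g)
  (nabla : field R n M -> field R n M -> field R n M)
  (hnabla : levi_civita S g nabla)
  (P : field R n M) (hPsmooth : forall p, smooth_field_at S P p)
  (hPunit : unit_timelike g P)
  (hGRW : GRW_spacetime S g)
  (hPconn : parallel S (semi_symmetric_connection g P nabla) P)
  (hfluid : perfect_fluid S g P nabla)
  (p : M) (U V X Y : field R n M)
  (hU : smooth_field_at S U p) (hV : smooth_field_at S V p)
  (hX : smooth_field_at S X p) (hY : smooth_field_at S Y p) :
  curvature_dot_ricci S (semi_symmetric_connection g P nabla) U V X Y p = 0.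
Proof.
have [b ric] := ricci_fluid hg hnabla hPsmooth hPunit hPconn hfluid p.
set E := semi_symmetric_connection g P nabla in ric *.
have sB := smooth_lie_bracket hnabla hX hY.
have sR Z : smooth_field_at S Z p -> smooth_field_at S (curvature S E X Y Z) p.
  exact: (smooth_curvature hg hnabla hPsmooth hX hY).
have skew A B : smooth_field_at S A p -> smooth_field_at S B p ->
    metric g (curvature S E X Y A) B p + metric g A (curvature S E X Y B) p = 0.
  apply: curvature_skew sB hX hY; first exact: metric_smooth.
    exact: (semi_symmetric_smooth hg hnabla hPsmooth).
  exact: (semi_symmetric_metric hg hnabla).
have orthP A : smooth_field_at S A p -> metric g (curvature S E X Y A) P p = 0.
  move=> sA; have := skew A P sA (hPsmooth p).
  rewrite [metric g A _ p]metricE.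
  rewrite (curvature_P hnabla hPconn hX hY).
  by rewrite form0r addr0.
have [sRU sRV] := (sR U hU, sR V hV).
rewrite /curvature_dot_ricci (ric _ _ sRU hV) (ric _ _ hU sRV).
rewrite (orthP U hU) (orthP V hV) mul0r mulr0 !addr0.
have := skew U V hU hV => /eqP; rewrite addr_eq0 => /eqP ->.
by ring.
Qed.
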